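(* Let $D$ be a digraph of order $n$. Order its vertices as $u_1,\dots,u_n$ so that $deg^+(u_1)\geq deg^+(u_2)\geq\dots\geq deg^+(u_n)$, and let $t^+(D):=\max\{i : deg^+(u_i)\geq i-1\}$, i.e. the maximum number $i$ such that $D$ contains at least $i$ vertices of out-degree at least $i-1$. Order the vertices as $v_1,\dots,v_n$ so that $deg^-(v_1)\geq deg^-(v_2)\geq\dots\geq deg^-(v_n)$, and let $t^-(D):=\max\{i : deg^-(v_i)\geq i-1\}$, i.e. the maximum number $i$ such that $D$ contains at least $i$ vertices of in-degree at least $i-1$. Then \[dib(D)\leq t(D):=\min\{t^+(D),t^-(D)\}.\]
   Context: All digraphs are finite, loopless, and simple: $D=(V,A)$ where $A$ is a set of ordered pairs $uv$ (darts) of distinct vertices; both $uv$ and $vu$ may be darts. $deg^+(u)$ is the number of darts $uw$ and $deg^-(u)$ the number of darts $wu$. A coloring of $D$ with $k$ colors is a surjective map $\varsigma:V\to\{1,\dots,k\}$; it is acyclic if each color class induces a subdigraph with no directed cycle. With respect to $\varsigma$, a vertex $u$ is a $b^+$-vertex if for every color $j\neq\varsigma(u)$ there is a dart $uw$ with $\varsigma(w)=j$, and a $b^-$-vertex if for every color $j\neq \varsigma(u)$ there is a dart $wu$ with $\varsigma(w)=j$. A $b$-coloring is a coloring in which every color class contains a $b^+$-vertex and a $b^-$-vertex. The dib-chromatic number $dib(D)$ is the largest $k$ such that $D$ admits an acyclic $b$-coloring with $k$ colors. *)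

(* Defs.v *)
From mathcomp Require Import all_boot.
From mathcomp Require Import boolp.

Set Implicit Arguments.
Unset Strict Implicit.
Unset Printing Implicit Defensive.

Record digraph (V : finType) := Digraph {
  dart :> rel V;
  dart_irrefl : irreflexive dart
}.

Section Digraphs.
Variables (V : finType) (D : digraph V).
Implicit Types u v w : V.

Definition outdeg u := #|[set w | D u w]|.
Definition indeg u := #|[set w | D w u]|.

(* Digons count as directed cycles: [:: u; v] is one when both uv and vu are
   darts. A one-vertex cycle would be a loop, which [dart_irrefl] excludes. *)
Definition acyclic_in (A : {set V}) : Prop :=
  forall s : seq V, s != [::] -> {subset s <= A} -> ~~ (cycle D s && uniq s).

Section Colorings.
Variables (k : nat) (c : V -> 'I_k).

Definition color_class (j : 'I_k) := [set u | c u == j].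

Definition is_coloring : Prop := forall j, exists u, c u = j.

Definition acyclic_coloring : Prop :=
  is_coloring /\ forall j, acyclic_in (color_class j).

Definition bplus_vertex u : Prop :=
  forall j, j != c u -> exists2 w, D u w & c w = j.

Definition bminus_vertex u : Prop :=
  forall j, j != c u -> exists2 w, D w u & c w = j.

Definition b_coloring : Prop :=
  is_coloring /\
  forall j, (exists2 u, u \in color_class j & bplus_vertex u) /\
            (exists2 u, u \in color_class j & bminus_vertex u).

End Colorings.

Definition has_acyclic_b_coloring (k : nat) : Prop :=
  exists c : V -> 'I_k, acyclic_coloring c /\ b_coloring c.

(* The range k <= #|V| loses nothing, and the maximum is always attained:
   see [dib_max] and [dib_attained]. *)
Definition dib : nat :=
  \max_(k < #|V|.+1 | `[< has_acyclic_b_coloring k >]) k.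

Definition outdegs : seq nat := sort geq [seq outdeg u | u <- enum V].
Definition indegs : seq nat := sort geq [seq indeg u | u <- enum V].

(* Entry i of the sorted sequence is the degree of the (i+1)-st vertex, whence
   the shift. *)
Definition t_plus : nat := \max_(i < #|V| | i <= nth 0 outdegs i) i.+1.
Definition t_minus : nat := \max_(i < #|V| | i <= nth 0 indegs i) i.+1.

Definition t : nat := minn t_plus t_minus.

End Digraphs.

Lemma coloring_leq (V : finType) k (c : V -> 'I_k) : is_coloring c -> k <= #|V|.
Proof.
move=> cS; have -> : k = #|[set c u | u in V]|.
  rewrite -[LHS]card_ord; apply: eq_card => j; symmetry; apply/imsetP.
  by have [u <-] := cS j; exists u.
exact: leq_imset_card.
Qed.

Lemma dib_max (V : finType) (D : digraph V) k :
  has_acyclic_b_coloring D k -> k <= dib D.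
Proof.
move=> Hk; have lekV : k < #|V|.+1.
  by case: Hk => c [[cS _] _]; rewrite ltnS (coloring_leq cS).
by apply: (leq_bigmax_cond (Ordinal lekV)); apply/asboolP.
Qed.

(* A color class without b^+-vertices (dually, b^- -vertices) can be dissolved
   into the other classes of an acyclic coloring. *)
Lemma dissolve_class (V : finType) (D : digraph V) (e : rel V) k
    (c : V -> 'I_k.+1) j :
    (forall s, cycle D s && uniq s ->
       exists s', [/\ s' =i s, uniq s' & cycle e s']) ->
    acyclic_coloring D c ->
    (forall u, c u = j -> exists2 i, i != j & forall w, e u w -> c w != i) ->
  exists c' : V -> 'I_k, acyclic_coloring D c'.
Proof.
move=> eD [cS cA] Hj.
have /choice[f fP] u : exists i : 'I_k,
    if c u == j then forall w, e u w -> c w != lift j i else c u = lift j i.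
  case: eqP => [/Hj[i ij iw]|/eqP cj].
    by case: (unlift_some (_ : j != i)) iw => [|i' -> _ iw]; [rewrite eq_sym|exists i'].
  by case: (unlift_some (_ : j != c u)) => [|i' -> _]; [rewrite eq_sym|exists i'].
exists f; split=> [i|i s sN0 sA].
  have [u cu] := cS (lift j i); exists u; move: (fP u).
  by rewrite cu eq_sym (negPf (neq_lift j i)) => /lift_inj.
apply/negP => sC; have [s' [s's s'U s'C]] := eD _ sC.
have fs u : u \in s -> f u = i by move/sA; rewrite inE => /eqP.
have [/hasP[u us' cu]|/hasPn nj] := boolP (has (fun u => c u == j) s'); last first.
  have sub : {subset s <= color_class c (lift j i)}.
    move=> u us; rewrite inE; move: (fP u).
    by rewrite (negPf (nj u _)) ?s's // fs // => ->.
  by case/negP: (cA _ s sN0 sub).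
suff sj : {subset s <= color_class c j} by case/negP: (cA j s sN0 sj).
move=> w ws; rewrite inE.
have [n p rs] := rot_to us'.
have pC : path e u p.
  by move: s'C; rewrite -(rot_cycle n) rs /= rcons_path => /andP[].
have ps v : v \in u :: p -> f v = i by rewrite -rs mem_rot s's => /fs.
have : w \in u :: p by rewrite -rs mem_rot s's.
move: ps cu pC {rs us'}.
elim: p u => [|v p IH] u ps cu; first by rewrite inE => _ /eqP ->.
move=> /= /andP[uv vp]; rewrite inE => /predU1P[-> //|wvp].
apply: IH wvp => // [x xp|]; first by apply: ps; rewrite inE xp orbT.
apply: contraT => cv; move: (fP v); rewrite (negPf cv) ps ?inE ?eqxx ?orbT //.
by move=> cvi; move: (fP u); rewrite cu ps ?mem_head // => /(_ _ uv); rewrite cvi eqxx.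
Qed.

Lemma dib_attained (V : finType) (D : digraph V) : has_acyclic_b_coloring D (dib D).
Proof.
suff [k Hk] : exists k, has_acyclic_b_coloring D k.
  have lekV : k < #|V|.+1.
    by case: Hk => c [[cS _] _]; rewrite ltnS (coloring_leq cS).
  rewrite /dib (bigmax_eq_arg (Ordinal lekV)); last exact/asboolP.
  by case: arg_maxnP => [|i /asboolP //]; apply/asboolP.
have ex : exists k, `[< exists c : V -> 'I_k, acyclic_coloring D c >].
  exists #|V|; apply/asboolP; exists enum_rank; split=> [j|j s sN0 sA].
    by exists (enum_val j); rewrite enum_valK.
  have sj u : u \in s -> u = enum_val j.
    by move/sA; rewrite inE => /eqP <-; rewrite enum_rankK.
  case: s sN0 sA sj => [//|x [|y s]] _ _ sj.
    by rewrite /= (dart_irrefl D).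
  have xy : x = y.
    by rewrite (sj x (mem_head _ _)) [RHS](sj y) // inE mem_head orbT.
  by apply/negP; rewrite xy => /andP[_] /=; rewrite mem_head.
have [k /asboolP[c cA] kmin] := ex_minnP ex; exists k; exists c; split=> //.
split=> [|j]; first by case: cA.
have noless (e : rel V) :
    (forall s, cycle D s && uniq s ->
       exists s', [/\ s' =i s, uniq s' & cycle e s']) ->
    exists2 u, u \in color_class c j &
      forall i, i != c u -> exists2 w, e u w & c w = i.
  move=> eD; apply: contrapT => no.
  case: k c cA kmin j no => [c _ _ [//]|k] c cA kmin j no.
  have [|c' c'A] := dissolve_class (j := j) eD cA.
    move=> u cu; apply: contrapT => no'; apply: no.
    exists u; first by rewrite inE cu.
    move=> i; rewrite cu => ij; apply: contrapT => no.
    apply: no'; exists i => // w uw; apply/eqP => cw; apply: no; exists w => //.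
  by have /kmin : `[< exists c0 : V -> 'I_k, acyclic_coloring D c0 >];
    [apply/asboolP; exists c' | rewrite ltnn].
split; first by apply: noless => s /andP[sC sU]; exists s.
apply: (noless (fun u w => D w u)) => s /andP[sC sU].
by exists (rev s); split; [exact: mem_rev | rewrite rev_uniq | rewrite rev_cycle].
Qed.

Lemma leq_nth_sort_geq (s : seq nat) i m :
  i < size s -> (m <= nth 0 (sort geq s) i) = (i < count (leq m) s).
Proof.
have tr : transitive geq by move=> y x z xy yz; apply: leq_trans yz xy.
have geq_tot : total geq by move=> x y; apply: leq_total.
rewrite -(count_sort geq) -(size_sort geq s).
have := sort_sorted geq_tot s; move: (sort geq s) => {}s.
elim: s i => [|x s IH] [|i] //= sS.
  case: (leqP m x) => [|lt] _ //=; symmetry; rewrite add0n; apply/negbTE; rewrite -eqn0Ngt.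
  rewrite -leqn0 leqNgt -has_count; apply/hasPn => y ys; rewrite -ltnNge.
  by apply: leq_ltn_trans lt; move: sS; rewrite (path_sortedE tr) => /andP[/allP/(_ _ ys)].
rewrite ltnS => lti; rewrite IH ?(path_sorted sS) //.
case: (leqP m x) => [_|lt]; first by rewrite add1n ltnS.
have -> : count (leq m) s = 0.
  apply/eqP; rewrite -leqn0 leqNgt -has_count; apply/hasPn => y ys; rewrite -ltnNge.
  by apply: leq_ltn_trans lt; move: sS; rewrite (path_sortedE tr) => /andP[/allP/(_ _ ys)].
by [].
Qed.

Lemma max_sorted_count (V : finType) (d : V -> nat) :
  \max_(i < #|V| | i <= nth 0 (sort geq [seq d u | u <- enum V]) i) i.+1 =
  \max_(i < #|V|.+1 | i <= #|[set u | i.-1 <= d u]|) i.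
Proof.
rewrite [RHS]big_mkcond big_ord_recl /= max0n big_mkcond.
apply: eq_bigr => i _; rewrite leq_nth_sort_geq; last by rewrite size_map -cardE.
suff -> : #|[set u | (lift ord0 i).-1 <= d u]| = count (leq i) [seq d u | u <- enum V].
  by [].
rewrite cardE count_map -size_filter enumT /enum_mem; congr size.
by apply: eq_filter => u; rewrite /= inE.
Qed.

Lemma t_plus_count (V : finType) (D : digraph V) :
  t_plus D = \max_(i < #|V|.+1 | i <= #|[set u | i.-1 <= outdeg D u]|) i.
Proof. exact: max_sorted_count. Qed.

Lemma t_minus_count (V : finType) (D : digraph V) :
  t_minus D = \max_(i < #|V|.+1 | i <= #|[set u | i.-1 <= indeg D u]|) i.
Proof. exact: max_sorted_count. Qed.

(* Main.v *)
Require Import Defs.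
From mathcomp Require Import all_boot.

(** Take a b-coloring with k = [dib D] colors. A b^+-vertex sees the k-1 other colors, so its
    out-degree is at least k-1; one such vertex in each class gives k of them, so k competes in the
    maximum defining [t_plus]. Reversing darts handles [t_minus], hence the arbitrary relation
    [e]. *)

Lemma leq_card_degree (V : finType) (e : rel V) k (c : V -> 'I_k) u :
  (forall j, j != c u -> exists2 w, e u w & c w = j) ->
  k.-1 <= #|[set w | e u w]|.
Proof.
move=> eu; have <- : #|[set~ c u]| = k.-1 by rewrite cardsC1 card_ord.
apply: leq_trans (leq_imset_card c _); apply/subset_leq_card/subsetP => j.
by rewrite !inE => /eu[w uw <-]; apply: imset_f; rewrite inE.
Qed.

(** [c] maps the vertices of high degree onto all k colors. *)
Lemma leq_card_high_degree (V : finType) (e : rel V) k (c : V -> 'I_k) :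
  (forall j, exists2 u, u \in color_class c j &
     forall i, i != c u -> exists2 w, e u w & c w = i) ->
  k <= #|[set u | k.-1 <= #|[set w | e u w]|]|.
Proof.
move=> cb; rewrite -{1}(card_ord k) -cardsT.
apply: leq_trans (leq_imset_card c _); apply/subset_leq_card/subsetP => j _.
have [u] := cb j; rewrite inE => /eqP <- /leq_card_degree du.
by apply: imset_f; rewrite inE.
Qed.

Theorem theorem1 (V : finType) (D : digraph V) : dib D <= t D.
Proof.
have [c [_ [cS cb]]] := dib_attained D.
(* Makes [dib D] a legal index of both maxima. *)
have ltV : dib D < #|V|.+1 by rewrite ltnS (coloring_leq cS).
rewrite leq_min t_plus_count t_minus_count; apply/andP; split.
  apply: (leq_bigmax_cond (Ordinal ltV)).
  by apply: (leq_card_high_degree _ (dart D) _ c) => j; case: (cb j).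
apply: (leq_bigmax_cond (Ordinal ltV)).
(* In the reversed relation, b^- -vertices play the part of b^+-vertices. *)
by apply: (leq_card_high_degree _ (fun u w => D w u) _ c) => j; case: (cb j).
Qed.
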